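(* Let $g:\mathcal{X}\to\mathcal{Z}$ be one-to-one and onto, let $\mathbf{f}$ be linearly equivariant with respect to $g$ with nonsingular matrix $\mathbf{Q}_g$, i.e. $\mathbf{f}(g(\mathbf{x}))=\mathbf{Q}_g\mathbf{f}(\mathbf{x})$ for all $\mathbf{x}\in\mathcal{X}$, and let $\tilde g(\boldsymbol\beta)=\mathbf{Q}_g^{-\mathsf T}\boldsymbol\beta$ for $\boldsymbol\beta\in\mathcal{B}$. Let $\boldsymbol\beta\in\mathcal{B}$ and let $\nu$ be a probability measure on $\mathcal{X}$. If $\xi^*$ is locally $IMSE$-optimal on $\mathcal{X}$ at $\boldsymbol\beta$ with respect to $\nu$, then $(\xi^* )^g$ is locally $IMSE$-optimal on $\mathcal{Z}$ at $\tilde{\boldsymbol\beta}=\tilde g(\boldsymbol\beta)$ with respect to the image measure $\nu^g$.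
   Context: $\mathbf{f}$ is a vector of $p$ real regression functions defined on $\mathcal{X}$ and on $\mathcal{Z}$, with components linearly independent on $\mathcal{X}$; $\mathcal{B}\subseteq\mathbb{R}^p$ is the parameter region; $\lambda$ (the intensity function) is a positive real function defined on a set of reals containing all values $\mathbf{f}(\mathbf{x})^{\mathsf T}\boldsymbol\beta$, $\mathbf{x}\in\mathcal{X}$, $\boldsymbol\beta\in\mathcal{B}$; the same $\lambda$ is used on $\mathcal{Z}$. A design $\xi$ on a region is given by finitely many distinct support points $\mathbf{x}_i$ of the region and weights $w_i>0$, $\sum_i w_i=1$. Its information matrix is $\mathbf{M}(\xi;\boldsymbol\beta)=\sum_i w_i\,\lambda(\mathbf{f}(\mathbf{x}_i)^{\mathsf T}\boldsymbol\beta)\,\mathbf{f}(\mathbf{x}_i)\mathbf{f}(\mathbf{x}_i)^{\mathsf T}$. The image $\xi^g$ is the design on $\mathcal{Z}$ with support points $g(\mathbf{x}_i)$ and weights $w_i$; $\nu^g$ is the image (pushforward) of $\nu$ under $g$. With $\mathbf{V}(\boldsymbol\beta;\nu)=\int\lambda(\mathbf{f}(\mathbf{x})^{\mathsf T}\boldsymbol\beta)^2\,\mathbf{f}(\mathbf{x})\mathbf{f}(\mathbf{x})^{\mathsf T}\,\nu(\mathrm{d}\mathbf{x})$, the $IMSE$-criterion is $\mathrm{IMSE}(\xi;\boldsymbol\beta,\nu)=\mathrm{trace}(\mathbf{V}(\boldsymbol\beta;\nu)\mathbf{M}(\xi;\boldsymbol\beta)^{-1})$, set to $\infty$ when $\mathbf{M}(\xi;\boldsymbol\beta)$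 is singular (this is the form for a generalized linear model with canonical link). A design is locally $IMSE$-optimal at $\boldsymbol\beta$ with respect to $\nu$ on a region if it minimizes this criterion over all designs on that region. $\mathbf{f}$, $\lambda$, $g$, $g^{-1}$ are measurable and the integrals $\mathbf{V}$ are finite. $\mathbf{Q}^{-\mathsf T}$ denotes the inverse of the transpose of $\mathbf{Q}$. *)

(* Defs.v *)
From HB Require Import structures.
From mathcomp Require Import all_boot all_order all_algebra.
From mathcomp Require Import all_classical all_reals all_analysis.

Set Implicit Arguments.
Unset Strict Implicit.
Unset Printing Implicit Defensive.

Import Order.TTheory GRing.Theory Num.Theory.
Import numFieldNormedType.Exports.

Local Open Scope classical_set_scope.
Local Open Scope ring_scope.

(* A region is the whole of a type; a proper subset
   of some larger space is covered by taking it as a type of its own. *)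

Record design (R : realType) (T : Type) := Design {
  dsize : nat;
  dpoint : 'I_dsize -> T;
  dweight : 'I_dsize -> R;
  dpoint_inj : injective dpoint;
  dweight_gt0 : forall i, 0 < dweight i;
  dweight_sum1 : \sum_(i < dsize) dweight i = 1 }.

Definition design_image (R : realType) (T U : Type) (g : T -> U)
    (ginj : injective g) (xi : design R T) : design R U :=
  Design (inj_comp ginj (@dpoint_inj R T xi)) (@dweight_gt0 R T xi)
    (dweight_sum1 xi).

Section Regression.
Variables (R : realType) (p : nat).

Definition lin_indep_functions (T : Type) (f : T -> 'cV[R]_p) : Prop :=
  forall c : 'I_p -> R,
    (forall x, \sum_(i < p) c i * f x i ord0 = 0) -> forall i, c i = 0.

Definition linear_equivariant (T U : Type) (g : T -> U)
    (fT : T -> 'cV[R]_p) (fU : U -> 'cV[R]_p) (Q : 'M[R]_p) : Prop :=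
  forall x, fU (g x) = Q *m fT x.

Definition param_map (Q : 'M[R]_p) (beta : 'cV[R]_p) : 'cV[R]_p :=
  invmx Q^T *m beta.

Definition lin_predictor (T : Type) (f : T -> 'cV[R]_p) (beta : 'cV[R]_p)
    (x : T) : R :=
  ((f x)^T *m beta) ord0 ord0.

Definition info_matrix (T : Type) (f : T -> 'cV[R]_p) (lambda : R -> R)
    (xi : design R T) (beta : 'cV[R]_p) : 'M[R]_p :=
  \sum_(i < dsize xi)
    (dweight i * lambda (lin_predictor f beta (dpoint i))) *:
      (f (dpoint i) *m (f (dpoint i))^T).

Definition measurable_vector d (T : measurableType d) (f : T -> 'cV[R]_p) :
    Prop :=
  forall i, measurable_fun [set: T] (fun x => f x i ord0).

(* Measurability with respect to the trace on [D] of the Borel sigma-algebra;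
   unlike in [measurable_fun D h], [D] itself need not be Borel. *)
Definition trace_measurable (D : set R) (h : R -> R) : Prop :=
  preimage_set_system D h measurable `<=` strace measurable D.

Definition V_integrand (T : Type) (f : T -> 'cV[R]_p) (lambda : R -> R)
    (beta : 'cV[R]_p) (x : T) : 'M[R]_p :=
  lambda (lin_predictor f beta x) ^+ 2 *: (f x *m (f x)^T).

Definition V_finite d (T : measurableType d) (f : T -> 'cV[R]_p)
    (lambda : R -> R) (beta : 'cV[R]_p) (nu : probability T R) : Prop :=
  forall i j,
    nu.-integrable [set: T] (EFin \o (fun x => V_integrand f lambda beta x i j)).

(* [Rintegral] is total: the entries are meaningful only under [V_finite]. *)
Definition V_matrix d (T : measurableType d) (f : T -> 'cV[R]_p)
    (lambda : R -> R) (beta : 'cV[R]_p) (nu : probability T R) : 'M[R]_p :=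
  \matrix_(i, j) \int[nu]_(x in [set: T]) V_integrand f lambda beta x i j.

Definition IMSE d (T : measurableType d) (f : T -> 'cV[R]_p) (lambda : R -> R)
    (xi : design R T) (beta : 'cV[R]_p) (nu : probability T R) : \bar R :=
  let M := info_matrix f lambda xi beta in
  if M \in unitmx then (\tr (V_matrix f lambda beta nu *m invmx M))%:E
  else +oo%E.

Definition IMSE_optimal d (T : measurableType d) (f : T -> 'cV[R]_p)
    (lambda : R -> R) (beta : 'cV[R]_p) (nu : probability T R)
    (xi : design R T) : Prop :=
  forall xi' : design R T,
    (IMSE f lambda xi beta nu <= IMSE f lambda xi' beta nu)%E.

End Regression.

(* Main.v *)
(* Passing from f, beta to Q f, Q^-T beta leaves the linear predictor unchanged,
   so it turns M and V into Q M Q^T and Q V Q^T, and trace (V M^-1) is invariant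
   under this simultaneous congruence.  Hence the criterion of xi^g on Z equals
   that of xi on X, and every design on Z is an image under g. *)
Require Import Defs.
From HB Require Import structures.
From mathcomp Require Import all_boot all_order all_algebra.
From mathcomp Require Import all_classical all_reals all_analysis.
From mathcomp Require Import measurable_realfun.

Import Order.TTheory GRing.Theory Num.Theory.
Import numFieldNormedType.Exports.

Local Open Scope classical_set_scope.
Local Open Scope ring_scope.

Set Implicit Arguments.
Unset Strict Implicit.
Unset Printing Implicit Defensive.

Lemma Rintegral_sum d (T : measurableType d) (R : realType)
    (mu : {measure set T -> \bar R}) (D : set T) (I : Type) (s : seq I)
    (h : I -> T -> R) (mD : measurable D)
    (inth : forall i, mu.-integrable D (EFin \o h i)) :
  \int[mu]_(x in D) (\sum_(i <- s) h i x) =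
  \sum_(i <- s) \int[mu]_(x in D) h i x.
Proof.
rewrite /Rintegral; under eq_integral do rewrite -sumEFin.
(* [fine] is additive only on finite values, so integrability of each term is used again after the
   extended-real integral has been split. *)
rewrite (integral_sum mD inth) -(@sum_fine _ _ s xpredT)// => i _.
exact: (integrable_fin_num mD (inth i)).
Qed.

Lemma measurable_congr_mx d (T : measurableType d) (R : realType) (p : nat)
    (h : T -> 'M[R]_p) (A B : 'M[R]_p)
    (mh : forall i j, measurable_fun [set: T] (fun x => h x i j)) i j :
  measurable_fun [set: T] (fun x => (A *m h x *m B) i j).
Proof.
under eq_fun do rewrite mxE; apply: measurable_sum => l.
under eq_fun do rewrite mxE; apply: measurable_funM => //.
by apply: measurable_sum => k; apply: measurable_funM.
Qed.

Lemma integrable_mulmxl d (T : measurableType d) (R : realType) (p : nat)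
    (mu : {measure set T -> \bar R}) (h : T -> 'M[R]_p) (A : 'M[R]_p)
    (inth : forall i j, mu.-integrable [set: T] (EFin \o (fun x => h x i j)))
    i j :
  mu.-integrable [set: T] (EFin \o (fun x => (A *m h x) i j)).
Proof.
rewrite (_ : _ \o _ =
  fun x => (\sum_(k < p) (A i k)%:E * (h x k j)%:E)%E); last first.
  by apply/funext => x; rewrite /= mxE -sumEFin.
by apply: integrable_sum => // k _; apply: integrableZl => //; exact: inth.
Qed.

Lemma integrable_mulmxr d (T : measurableType d) (R : realType) (p : nat)
    (mu : {measure set T -> \bar R}) (h : T -> 'M[R]_p) (B : 'M[R]_p)
    (inth : forall i j, mu.-integrable [set: T] (EFin \o (fun x => h x i j)))
    i j :
  mu.-integrable [set: T] (EFin \o (fun x => (h x *m B) i j)).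
Proof.
(* Transposition turns right multiplication by [B] into left multiplication by [B^T]. *)
rewrite (_ : _ \o _ = EFin \o (fun x => (B^T *m (h x)^T) j i)); last first.
  by apply/funext => x; rewrite /= -trmx_mul [in RHS]mxE.
apply: integrable_mulmxl => k l.
rewrite (_ : (fun x => _) = (fun x => h x l k)) //.
by apply/funext => x; rewrite mxE.
Qed.

(** Linearity of the integral, applied entrywise to the two nested sums of the product; with [A = Q]
    and [B = Q^T] it moves the congruence out of [V_matrix]. *)
Lemma Rintegral_congr_mx d (T : measurableType d) (R : realType) (p : nat)
    (mu : {measure set T -> \bar R}) (h : T -> 'M[R]_p) (A B : 'M[R]_p)
    (inth : forall i j, mu.-integrable [set: T] (EFin \o (fun x => h x i j))) :
  \matrix_(i, j) \int[mu]_(x in [set: T]) (A *m h x *m B) i j =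
  A *m (\matrix_(i, j) \int[mu]_(x in [set: T]) h x i j) *m B.
Proof.
apply/matrixP => i j; rewrite !mxE.
under eq_Rintegral do rewrite mxE.
rewrite Rintegral_sum //; last first.
  move=> l; rewrite (_ : _ \o _ =
    fun x => (((A *m h x) i l)%:E * (B l j)%:E)%E)//.
  by apply: integrableZr => //; exact: integrable_mulmxl.
apply: eq_bigr => l _.
rewrite RintegralZr//; last exact: integrable_mulmxl.
congr (_ * _); rewrite !mxE; under eq_Rintegral do rewrite mxE.
rewrite Rintegral_sum //; last first.
  by move=> k; exact: (integrableZl measurableT (A i k) (inth k l)).
by apply: eq_bigr => k _; rewrite RintegralZl// mxE.
Qed.

(** Cyclicity of the trace brings the leading [Q] to the far right, where it meets the inverse and
    leaves [Q^T (Q M Q^T)^-1 Q = M^-1]. *)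
Lemma mxtrace_congr_inv (R : comUnitRingType) (p : nat) (Q V M : 'M[R]_p)
    (Q_unit : Q \in unitmx) (M_unit : M \in unitmx) :
  \tr (Q *m V *m Q^T *m invmx (Q *m M *m Q^T)) = \tr (V *m invmx M).
Proof.
have N_unit : Q *m M *m Q^T \in unitmx.
  by rewrite !unitmx_mul Q_unit M_unit unitmx_tr.
rewrite -!mulmxA mxtrace_mulC -!mulmxA; congr (\tr (V *m _)).
(* Multiplying both sides on the left by [M] and then by [Q] completes the product [Q M Q^T] next to
   its own inverse, so that inverse never has to be expanded. *)
apply: (can_inj (mulKmx M_unit)); apply: (can_inj (mulKmx Q_unit)).
by rewrite mulmxV // mulmx1 !mulmxA mulmxV // mul1mx.
Qed.

Section Equivariance.
Variables (R : realType) (p : nat) (Q : 'M[R]_p) (Q_unit : Q \in unitmx).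
Variables (lambda : R -> R) (beta : 'cV[R]_p).

(** The factor [Q^T] produced by transposing [Q f(x)] cancels the [invmx Q^T] in [param_map]; hence
    [lambda] is evaluated at the same argument on both regions. *)
Lemma lin_predictor_equivariant (T U : Type) (g : T -> U)
    (fT : T -> 'cV[R]_p) (fU : U -> 'cV[R]_p)
    (f_equivariant : linear_equivariant g fT fU Q) x :
  lin_predictor fU (param_map Q beta) (g x) = lin_predictor fT beta x.
Proof.
rewrite /lin_predictor /param_map f_equivariant trmx_mul -mulmxA.
by rewrite mulKVmx ?unitmx_tr.
Qed.

Lemma info_matrix_equivariant (T U : Type) (g : T -> U) (g_inj : injective g)
    (fT : T -> 'cV[R]_p) (fU : U -> 'cV[R]_p)
    (f_equivariant : linear_equivariant g fT fU Q) (xi : design R T) :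
  info_matrix fU lambda (design_image g_inj xi) (param_map Q beta) =
  Q *m info_matrix fT lambda xi beta *m Q^T.
Proof.
rewrite /info_matrix mulmx_sumr mulmx_suml; apply: eq_bigr => i _ /=.
rewrite (lin_predictor_equivariant f_equivariant) f_equivariant trmx_mul.
by rewrite -scalemxAr -scalemxAl !mulmxA.
Qed.

Lemma V_integrand_equivariant (T U : Type) (g : T -> U)
    (fT : T -> 'cV[R]_p) (fU : U -> 'cV[R]_p)
    (f_equivariant : linear_equivariant g fT fU Q) x :
  V_integrand fU lambda (param_map Q beta) (g x) =
  Q *m V_integrand fT lambda beta x *m Q^T.
Proof.
rewrite /V_integrand (lin_predictor_equivariant f_equivariant) f_equivariant.
by rewrite trmx_mul -scalemxAr -scalemxAl !mulmxA.
Qed.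

Lemma V_matrix_equivariant (dX dZ : measure_display) (X : measurableType dX)
    (Z : measurableType dZ) (fX : X -> 'cV[R]_p) (fZ : Z -> 'cV[R]_p)
    (g : {mfun X >-> Z}) (ginv : {mfun Z >-> X}) (ginvK : cancel ginv g)
    (f_equivariant : linear_equivariant g fX fZ Q)
    (nu : probability X R) (nu_finite : V_finite fX lambda beta nu) :
  V_matrix fZ lambda (param_map Q beta) (distribution nu g) =
  Q *m V_matrix fX lambda beta nu *m Q^T.
Proof.
rewrite /V_matrix -Rintegral_congr_mx//.
apply/matrixP => i j; rewrite !mxE /Rintegral; congr fine.
(* Change of variables for the image measure; it asks for measurability of the integrand on [Z] and
   integrability of its pullback to [X]. *)
rewrite integral_distribution.
- apply: eq_integral => x _ /=.
  by rewrite (V_integrand_equivariant f_equivariant).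
(* Since [g (ginv z) = z], the integrand on [Z] is the congruent integrand on [X] composed with the
   measurable [ginv]; measurability on [X] is part of the integrability in [nu_finite]. *)
- apply/measurable_EFinP.
  rewrite (_ : (fun z => _) =
    (fun x => (Q *m V_integrand fX lambda beta x *m Q^T) i j) \o ginv).
    apply: measurableT_comp => //.
    apply: measurable_congr_mx => k l; apply/measurable_EFinP.
    exact: measurable_int (nu_finite k l).
  apply/funext => z /=.
  by rewrite -(V_integrand_equivariant f_equivariant) ginvK.
- rewrite (_ : _ \o _ = EFin \o
    (fun x => (Q *m V_integrand fX lambda beta x *m Q^T) i j)).
    by apply: integrable_mulmxr => k l; exact: integrable_mulmxl.
  by apply/funext => x /=; rewrite (V_integrand_equivariant f_equivariant).
Qed.

Lemma IMSE_equivariant (dX dZ : measure_display) (X : measurableType dX)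
    (Z : measurableType dZ) (fX : X -> 'cV[R]_p) (fZ : Z -> 'cV[R]_p)
    (g : {mfun X >-> Z}) (g_inj : injective g) (ginv : {mfun Z >-> X})
    (ginvK : cancel ginv g) (f_equivariant : linear_equivariant g fX fZ Q)
    (nu : probability X R) (nu_finite : V_finite fX lambda beta nu)
    (xi : design R X) :
  IMSE fZ lambda (design_image g_inj xi) (param_map Q beta)
    (distribution nu g) = IMSE fX lambda xi beta nu.
Proof.
rewrite /IMSE (info_matrix_equivariant g_inj f_equivariant).
rewrite (V_matrix_equivariant ginvK f_equivariant nu_finite).
(* [Q M Q^T] is invertible exactly when [M] is, so both criteria take the value [+oo] for the same
   designs. *)
rewrite !unitmx_mul unitmx_tr Q_unit andbT /=.
by case: ifPn => // M_unit; rewrite mxtrace_congr_inv.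
Qed.

End Equivariance.

(** The criterion sees a design only through its information matrix, so comparing these matrices
    replaces an equality between design records, whose point maps agree only pointwise. *)
Lemma info_matrix_design_imageK (R : realType) (p : nat) (T U : Type)
    (f : T -> 'cV[R]_p) (lambda : R -> R) (beta : 'cV[R]_p) (g : U -> T)
    (ginv : T -> U) (ginvK : cancel ginv g) (g_inj : injective g)
    (ginv_inj : injective ginv) (xi : design R T) :
  info_matrix f lambda (design_image g_inj (design_image ginv_inj xi)) beta =
  info_matrix f lambda xi beta.
Proof. by apply: eq_bigr => i _ /=; rewrite ginvK. Qed.

Theorem corollary2
  (R : realType) (p : nat)
  (dX dZ : measure_display) (X : measurableType dX) (Z : measurableType dZ)
  (fX : X -> 'cV[R]_p) (fZ : Z -> 'cV[R]_p)
  (mfX : measurable_vector fX) (mfZ : measurable_vector fZ)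
  (fX_indep : lin_indep_functions fX)
  (B : set 'cV[R]_p)
  (D : set R) (lambda : R -> R)
  (D_predictor : forall x beta, B beta -> D (lin_predictor fX beta x))
  (lambda_gt0 : forall t, D t -> 0 < lambda t)
  (mlambda : trace_measurable D lambda)
  (g : {mfun X >-> Z}) (g_inj : injective g)
  (g_surj : forall z, exists x, g x = z)
  (ginv : {mfun Z >-> X}) (ginvK : cancel ginv g)
  (Q : 'M[R]_p) (Q_unit : Q \in unitmx)
  (f_equivariant : linear_equivariant g fX fZ Q)
  (beta : 'cV[R]_p) (B_beta : B beta)
  (nu : probability X R) (nu_finite : V_finite fX lambda beta nu)
  (xi : design R X)
  (xi_opt : IMSE_optimal fX lambda beta nu xi) :
  IMSE_optimal fZ lambda (param_map Q beta) (distribution nu g)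
    (design_image g_inj xi).
Proof.
move=> xi'; rewrite (IMSE_equivariant Q_unit g_inj ginvK f_equivariant)//.
(* A competitor on [Z] has the same criterion value as its image under [ginv], a design on [X] to
   which the optimality of [xi] applies. *)
have -> : IMSE fZ lambda xi' (param_map Q beta) (distribution nu g) =
    IMSE fX lambda (design_image (can_inj ginvK) xi') beta nu.
  rewrite -(IMSE_equivariant Q_unit g_inj ginvK f_equivariant)//.
  by rewrite /IMSE (info_matrix_design_imageK _ _ _ ginvK).
exact: xi_opt.
Qed.
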